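(* Let $n\geq 3$ and let $K_1,K_2\subset\mathbb{C}^n$ be strictly convex bodies, with $p_1$ an interior point of $K_1$ and $p_2$ an interior point of $K_2$. Suppose that for every complex linear hyperplane $H\subset\mathbb{C}^n$ (through the origin) the section $(H+p_1)\cap K_1$ is positively homothetic to $(H+p_2)\cap K_2$. Then $K_1$ is positively homothetic to $K_2$.
   Context: A convex body is a compact convex subset of $\mathbb{C}^n$ with nonempty interior; it is strictly convex if its boundary contains no nondegenerate real line segment. A set $A$ is positively homothetic to a set $B$ if $B=\lambda A+v$ for some real $\lambda>0$ and some $v\in\mathbb{C}^n$. Hyperplanes are complex hyperplanes (complex dimension $n-1$). *)

(* Defs.v *)
From mathcomp Require Import all_boot all_algebra.
From mathcomp Require Import all_classical all_reals all_analysis.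
From mathcomp Require Import complex.
Import GRing.Theory Num.Theory ComplexField numFieldNormedType.Exports.

Set Implicit Arguments.
Unset Strict Implicit.
Unset Printing Implicit Defensive.

Local Open Scope ring_scope.
Local Open Scope classical_set_scope.
Local Open Scope complex_scope.

Section ConvexC.
Variables (R : realType) (n : nat).

Definition realify (z : 'rV[R[i]]_n) : 'rV[R]_n * 'rV[R]_n :=
  (map_mx (@complex.Re R) z, map_mx (@complex.Im R) z).

Definition cinterior (K : set 'rV[R[i]]_n) : set 'rV[R[i]]_n :=
  [set z | (realify @` K)° (realify z)].
Definition cclosure (K : set 'rV[R[i]]_n) : set 'rV[R[i]]_n :=
  [set z | closure (realify @` K) (realify z)].
Definition cboundary (K : set 'rV[R[i]]_n) : set 'rV[R[i]]_n :=
  cclosure K `\` cinterior K.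
Definition ccompact (K : set 'rV[R[i]]_n) : Prop := compact (realify @` K).

Definition cconvex (K : set 'rV[R[i]]_n) : Prop :=
  forall a b, K a -> K b -> forall t : R, 0 <= t <= 1 ->
    K ((1 - t)%:C *: a + t%:C *: b).

Definition convex_body (K : set 'rV[R[i]]_n) : Prop :=
  [/\ cconvex K, ccompact K & cinterior K !=set0].

Definition strictly_convex_body (K : set 'rV[R[i]]_n) : Prop :=
  convex_body K /\
  forall a b : 'rV[R[i]]_n, a != b ->
    ~ (forall t : R, 0 <= t <= 1 -> cboundary K ((1 - t)%:C *: a + t%:C *: b)).

Definition pos_homothetic (A B : set 'rV[R[i]]_n) : Prop :=
  exists (lambda : R) (v : 'rV[R[i]]_n),
    0 < lambda /\ B = [set lambda%:C *: a + v | a in A].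

Definition csection (H : {vspace 'rV[R[i]]_n}) (p : 'rV[R[i]]_n)
    (K : set 'rV[R[i]]_n) : set 'rV[R[i]]_n :=
  [set h + p | h in [set h | h \in H]] `&` K.

End ConvexC.

(* Main.v *)
(** Translate so that [p1 = p2 = 0] and let [s] be the largest scalar with
    [s K2] contained in [K1]; then some [y] in [s K2] lies on the boundary of
    [K1]. For a hyperplane [H] through [y], the homothety taking the section
    of [K1] by [H] to that of [s K2] maps the section of [K1] into itself, so
    its ratio is at most 1. If it is 1 the map is the identity; otherwise its
    center is in [K1], and as [y] is a convex combination of the center and of
    its own preimage, strict convexity forces [y] to be fixed. All these
    homotheties thus have center [y], and they have the same ratio because the
    hyperplanes share the line through [0] and [y]. As [n >= 3], the
    hyperplanes through [y] cover the space. *)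

Require Import Defs.
From mathcomp Require Import all_boot all_order all_algebra.
From mathcomp Require Import all_classical all_reals all_analysis.
From mathcomp Require Import complex zify ring lra.
Import Order.TTheory GRing.Theory Num.Theory ComplexField.
Import numFieldNormedType.Exports.

Set Implicit Arguments.
Unset Strict Implicit.
Unset Printing Implicit Defensive.

Local Open Scope ring_scope.
Local Open Scope classical_set_scope.

(** * Archimedean bounds on multiples and powers *)

Lemma multiples_bounded_le0 (R : realType) (c M : R) :
  (forall k : nat, k%:R * c <= M) -> c <= 0.
Proof.
move=> h; rewrite leNgt; apply/negP => c0.
have := archi_boundP (normr_ge0 (M / c)).
rewrite ltNge => /negP; apply.
apply: le_trans (ler_norm _); rewrite ler_pdivlMr//; exact: h.
Qed.

(** For [1 < l], the Bernoulli-type bound [k * (l - 1) <= l ^+ k] reduces bounded powers to bounded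
    multiples. *)
Lemma powers_bounded_le1 (R : realType) (l c M : R) : 0 < c ->
  (forall k : nat, l ^+ k * c <= M) -> l <= 1.
Proof.
move=> c0 h; rewrite leNgt; apply/negP => l1.
suff : (l - 1) * c <= 0 by rewrite leNgt mulr_gt0// subr_gt0.
apply: (@multiples_bounded_le0 _ _ M) => k; apply: le_trans (h k).
rewrite mulrA ler_wpM2r// ?(ltW c0)//.
elim: k => [|k IH]; first by rewrite mul0r expr0.
have : 1 <= l ^+ k by rewrite exprn_ege1// ltW.
by rewrite exprS -natr1; nra.
Qed.

(** * Convexity, touching points and homotheties in a real normed space *)

Section Convex.
Variables (R : realType) (V : normedModType R).
Implicit Types (K : set V) (H : set V).

Definition segment_closed K := forall a b, K a -> K b ->
  forall t : R, 0 <= t <= 1 -> K ((1 - t) *: a + t *: b).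

(** The working form of strict convexity, derived below from the absence of segments in the
    boundary. *)
Definition segment_interior K := forall a b, K a -> K b -> a != b ->
  forall t : R, 0 < t < 1 -> K° ((1 - t) *: a + t *: b).

(** The homothety of center [a] and ratio [t] has a continuous inverse [f], which sends the point to
    [b]. Near that point [f] takes values in [K], and each [x] there lies on the segment from [a] to
    [f x]. *)
Lemma segment_to_interior K a b (t : R) : segment_closed K -> K a -> K° b ->
  0 < t <= 1 -> K° ((1 - t) *: a + t *: b).
Proof.
move=> cK Ka Kb /andP[t0 t1].
have tn : t != 0 by rewrite gt_eqF.
pose f x := t^-1 *: (x - (1 - t) *: a).
set p := (X in K° X).
have fp : f p = b by rewrite /f /p addrAC subrr add0r scalerA mulVf// scale1r.
have cf : f x @[x --> p] --> f p.
  by apply: cvgZr; apply: cvgB; [exact: cvg_id | exact: cvg_cst].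
have : \forall x \near p, K (f x) by apply: cf; rewrite fp.
apply: filterS => x Kf.
have -> : x = (1 - t) *: a + t *: f x.
  by rewrite /f scalerA mulfV// scale1r addrC subrK.
by apply: cK => //; rewrite t1 ltW.
Qed.

(** Were the point at [t] not interior, no point of the segment could be: for an interior point at
    [s], the point at [t] lies between it and one of the endpoints. The whole segment would then lie
    in the boundary. *)
Lemma segment_interior_of_boundary K : segment_closed K ->
  (forall a b, a != b ->
     ~ (forall t : R, 0 <= t <= 1 ->
          (closure K `\` K°) ((1 - t) *: a + t *: b))) ->
  segment_interior K.
Proof.
move=> cK sK a b Ka Kb ab t /andP[t0 t1].
apply: contrapT => nI; apply: (sK _ _ ab) => s s01.
split; first by apply: subset_closure; exact: cK.
move=> Is; apply: nI; case/andP: s01 => s0 s1.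
have [ts|st|->//] := ltgtP t s.
- have s_gt0 : 0 < s by apply: lt_trans ts.
  have := @segment_to_interior K a _ (t / s) cK Ka Is.
  rewrite scalerDr !scalerA addrA -scalerDl.
  have -> : t / s * s = t by rewrite mulfVK// gt_eqF.
  have -> : 1 - t / s + t / s * (1 - s) = 1 - t.
    by rewrite mulrBr mulr1 mulfVK ?gt_eqF// addrA subrK.
  by apply; rewrite divr_gt0//= ler_pdivrMr// mul1r ltW.
- have s_gt0 : 0 < 1 - s by rewrite subr_gt0 (lt_trans st).
  have sn : 1 - s != 0 by rewrite gt_eqF.
  have := @segment_to_interior K b _ ((1 - t) / (1 - s)) cK Kb Is.
  rewrite scalerDr !scalerA addrCA -scalerDl.
  have -> : (1 - t) / (1 - s) * (1 - s) = 1 - t by rewrite mulfVK.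
  have -> : 1 - (1 - t) / (1 - s) + (1 - t) / (1 - s) * s = t.
    by field.
  apply; apply/andP; split; first by rewrite divr_gt0// subr_gt0.
  by rewrite ler_pdivrMr// mul1r lerD2l lerN2 ltW.
Qed.

Lemma compact_norm_le K : compact K ->
  exists2 M : R, 0 < M & forall x, K x -> `|x| <= M.
Proof.
move=> /compact_bounded[M [_ hM]]; exists (`|M| + 1); first by rewrite ltr_pwDr.
by move=> x Kx; apply: hM => //=; rewrite ltr_pwDr// ler_norm.
Qed.

(** The factor is a supremum, attained because [K1] is closed. If every point of the dilated [K2]
    could be stretched further inside [K1], compactness of [K2] would give one common factor above
    1, against maximality. *)
Lemma exists_touching_dilation K1 K2 : compact K1 -> segment_closed K1 ->
  K1° 0 -> compact K2 -> (exists2 w, K2 w & w != 0) ->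
  exists2 s0 : R, 0 < s0 & (forall x, K2 x -> K1 (s0 *: x)) /\
    exists2 y, K2 y & forall s : R, 1 < s -> ~ K1 (s *: (s0 *: y)).
Proof.
move=> kK1 cK1 K10 kK2 [w K2w w0].
have clK1 : closed K1 by apply: compact_closed => //; exact: norm_hausdorff.
pose T := [set s : R | 0 <= s /\ forall x, K2 x -> K1 (s *: x)].
have [M1 M1gt0 K1M1] := compact_norm_le kK1.
have [M2 M2gt0 K2M2] := compact_norm_le kK2.
have [r1 r1gt0 r1K1] : exists2 r : R, 0 < r & forall x, `|x| < r -> K1 x.
  have /nbhs_ballP[r /= r0 hr] := K10.
  by exists r => // x xr; apply: hr; rewrite -ball_normE /ball_/= sub0r normrN.
have K1z : K1 0 by apply: r1K1; rewrite normr0.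
(* This factor sends [K2] into the open ball of radius [r1]; the [+ 1] makes the bound strict. *)
have T0 : T (r1 / (M2 + 1)).
  have M2p : 0 < M2 + 1 by rewrite addr_gt0.
  split; first by rewrite divr_ge0// ltW.
  move=> x /K2M2 xM; apply: r1K1; rewrite normrZ ger0_norm ?divr_ge0 ?ltW//.
  by rewrite mulrAC ltr_pdivrMr// ltr_pM2l//; lra.
have star (s : R) x : 0 <= s <= 1 -> K1 x -> K1 (s *: x).
  by move=> s01 K1x; have := cK1 _ _ K1z K1x _ s01; rewrite scaler0 add0r.
have wgt0 : 0 < `|w| by rewrite normr_gt0.
have ubT : has_ubound T.
  exists (M1 / `|w|) => s [s_ge0 sK]; rewrite ler_pdivlMr//.
  by have := K1M1 _ (sK _ K2w); rewrite normrZ ger0_norm.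
have supT : has_sup T by split => //; exists (r1 / (M2 + 1)).
pose s0 := sup T.
have s0gt0 : 0 < s0.
  apply: lt_le_trans (ub_le_sup ubT T0); rewrite divr_gt0//; lra.
have s0K x : K2 x -> K1 (s0 *: x).
  (* Any [s] just below [s0] is exceeded by some [t] in [T], and [K1] is star-shaped about 0; then
     let [s] tend to [s0]. *)
  move=> K2x; apply: (@closed_cvg _ _ (s0^'-) _ (fun s : R => s *: x) K1) => //.
    near=> s.
    have [t [t_ge0 tK] st] : exists2 t, T t & s < t.
      have [|t Tt st] := @sup_adherent _ T (s0 - s) _ supT.
        by rewrite subr_gt0; near: s; exact: nbhs_left_lt.
      by exists t => //; move: st; rewrite -/s0 subKr.
    have s_gt0 : 0 < s by near: s; exact: nbhs_left_gt.
    have t_gt0 : 0 < t by exact: lt_trans st.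
    have -> : s *: x = (s / t) *: (t *: x) by rewrite scalerA divfK// gt_eqF.
    apply: star (tK _ K2x).
    by rewrite divr_ge0 ?(ltW s_gt0) ?(ltW t_gt0)//= ler_pdivrMr// mul1r ltW.
  by apply: cvg_at_left_filter; apply: cvgZl; exact: cvg_id.
exists s0 => //; split => //; apply: contrapT => noy.
have : \forall s \near (1:R)^'+, K2 `<=` [set x | K1 (s *: (s0 *: x))].
  apply: (compact_near_coveringP K2).1 kK2 _ _ _ _ _ => y K2y.
  have [s1 s1gt1 K1s] : exists2 s1 : R, 1 < s1 & K1 (s1 *: (s0 *: y)).
    apply: contrapT => nos; apply: noy; exists y => // s s_gt1 K1s.
    by apply: nos; exists s.
  have s1gt0 : 0 < s1 by apply: lt_trans s1gt1.
  (* Keeping [s] below the midpoint of 1 and [s1] keeps [1 - s / s1] away from 0. *)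
  pose s2 := (1 + s1) / 2.
  have s2gt0 : 0 < s2 by rewrite /s2; lra.
  have s2s1 : s2 / s1 < 1 by rewrite ltr_pdivrMr// /s2; lra.
  have c_gt0 : 0 < s2 * s0 / (1 - s2 / s1).
    by rewrite divr_gt0 ?subr_gt0// mulr_gt0.
  (* The radius allowed for [y' - y]: it forces the vector [z] below into the ball of radius [r1],
     whatever [s] between 1 and [s2]. *)
  have e_gt0 : 0 < (s2 * s0 / (1 - s2 / s1))^-1 * r1.
    by rewrite mulr_gt0 ?invr_gt0.
  near=> y' s.
  have s_gt1 : 1 < s by near: s; exact: nbhs_right_gt.
  have s_lt : s < s2 by near: s; apply: nbhs_right_lt; rewrite /s2; lra.
  have s_gt0 : 0 < s by exact: lt_trans s_gt1.
  have ss1 : s / s1 < s2 / s1 by rewrite ltr_pM2r// invr_gt0.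
  have d0 : 0 < 1 - s / s1 by lra.
  (* Solved from the requirement that [s *: (s0 *: y')] be the convex combination of [z] and
     [s1 *: (s0 *: y)] with weight [s / s1] on the latter. *)
  pose z := (s * s0 / (1 - s / s1)) *: (y' - y).
  rewrite /=; have -> : s *: (s0 *: y') =
      (1 - s / s1) *: z + (s / s1) *: (s1 *: (s0 *: y)).
    rewrite !scalerA divfK ?gt_eqF// [(1 - _) * _]mulrC divfK ?gt_eqF//.
    by rewrite scalerBr subrK.
  apply: cK1 => //; last by rewrite divr_ge0 ?(ltW s_gt0) ?(ltW s1gt0)//=; lra.
  apply: r1K1; rewrite normrZ ger0_norm; last first.
    by rewrite divr_ge0 ?mulr_ge0// ltW.
  apply: (@le_lt_trans _ _ (s2 * s0 / (1 - s2 / s1) * `|y' - y|)).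
    rewrite ler_wpM2r// ler_pM ?mulr_ge0 ?invr_ge0 ?ltW// ?ltr_pM2r//.
    by rewrite ltf_pV2 ?posrE; lra.
  by rewrite -ltr_pdivlMl//; near: y'; exact: cvgr_distC_lt e_gt0.
move=> nearK2.
have [s [s_gt1 sK]] := filter_ex (filterI (nbhs_right_gt (1 : R)) nearK2).
have : T (s * s0).
  split=> [|x /sK]; last by rewrite -scalerA.
  by rewrite mulr_ge0// ltW// (lt_trans _ s_gt1).
move/(ub_le_sup ubT); rewrite -/s0 leNgt => /negP; apply.
by rewrite -[ltLHS]mul1r ltr_pM2r.
Unshelve. all: by end_near.
Qed.

Lemma touching_notin_interior K y :
  (forall s : R, 1 < s -> ~ K (s *: y)) -> ~ K° y.
Proof.
move=> touch Ky.
have : (fun s : R => s *: y) s @[s --> 1^'+] --> y.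
  apply: cvg_at_right_filter; rewrite -[X in _ --> X]scale1r.
  by apply: cvgZl; exact: cvg_id.
move=> /(_ _ Ky) nearK.
have [s [s_gt1 sK]] := filter_ex (filterI (nbhs_right_gt (1 : R)) nearK).
exact: touch s_gt1 sK.
Qed.

(** The conclusion says that [y] is fixed, in a form that also covers [l = 1]. Iterates of the map
    stay in the bounded set [K], which excludes [1 < l] and nonzero translations. *)
Lemma homothety_fixes_touching_point K A (l : R) v y : compact K ->
  segment_interior K -> A `<=` K -> A 0 -> 0 < l ->
  [set l *: x + v | x in A] `<=` A -> [set l *: x + v | x in A] y ->
  (forall s : R, 1 < s -> ~ K (s *: y)) -> v = (1 - l) *: y.
Proof.
move=> kK sK AK A0 l0 hA hAy touch.
have [M _ hM] := compact_norm_le kK.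
pose h x := l *: x + v.
have hiter k x : A x -> A (iter k h x).
  by move=> Ax; elim: k => //= k Ak; apply: hA; exists (iter k h x).
have yn0 : 0 < `|y|.
  rewrite normr_gt0; apply/eqP => y0; apply: (touch 2); first by lra.
  by rewrite y0 scaler0; exact: AK.
have dist k : iter k h y - iter k h 0 = l ^+ k *: y.
  elim: k => [|k IH] /=; first by rewrite subr0 expr0 scale1r.
  by rewrite /h opprD addrACA subrr addr0 -scalerBr IH scalerA exprS.
have l1 : l <= 1.
  apply: (@powers_bounded_le1 _ l `|y| (M + M)) => // k.
  have <- : `|l ^+ k *: y| = l ^+ k * `|y|.
    by rewrite normrZ ger0_norm// exprn_ge0// ltW.
  rewrite -dist (le_trans (ler_normB _ _))// lerD// hM//; apply: AK.
    exact/hiter/hA.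
  exact: hiter.
have [x Ax hx] := hAy.
move: l1; rewrite le_eqVlt => /predU1P[l1|l1].
  suff -> : v = 0 by rewrite l1 subrr scale0r.
  have itk k : iter k h 0 = k%:R *: v.
    elim: k => [|k IH] /=; first by rewrite scale0r.
    by rewrite IH /h l1 scale1r -natr1 scalerDl scale1r.
  apply/eqP; rewrite -normr_le0.
  apply: (@multiples_bounded_le0 _ _ M) => k.
  have <- : `|k%:R *: v| = k%:R * `|v| by rewrite normrZ ger0_norm.
  by rewrite -itk; apply/hM/AK/hiter.
have l1n : 1 - l != 0 by rewrite subr_eq0 gt_eqF.
pose c := (1 - l)^-1 *: v.
have vE : v = (1 - l) *: c by rewrite scalerA mulfV// scale1r.
(* The center is the limit of the iterates of 0, and [K] is closed. *)
have Kc : K c.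
  have itk k : iter k h 0 = (1 - l ^+ k) *: c.
    elim: k => [|k IH] /=; first by rewrite expr0 subrr scale0r.
    rewrite IH /h [in X in _ + X]vE scalerA -scalerDl; congr (_ *: _).
    by rewrite exprS; ring.
  have clK : closed K by apply: compact_closed => //; exact: norm_hausdorff.
  apply: (@closed_cvg _ _ \oo _ (fun k => (1 - l ^+ k) *: c) K) => //.
    by near=> k; rewrite -itk; apply/AK/hiter.
  rewrite -[X in _ --> X]scale1r; apply: cvgZl.
  rewrite -[X in _ --> X]subr0; apply: cvgB; first exact: cvg_cst.
  by apply: cvg_expr; rewrite ger0_norm// ltW.
(* Since [y] equals [(1 - l) *: c + l *: x], it would be interior if [x] and [c] differed. *)
have [xc|xc] := eqVneq x c.
  by rewrite -hx vE xc -scalerDl (addrC l) subrK scale1r.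
case: (touching_notin_interior touch).
have := sK c x Kc (AK _ Ax) _ l; rewrite -vE addrC hx; apply.
  by rewrite eq_sym.
by rewrite l0 l1.
Unshelve. all: by end_near.
Qed.

(** * Sections by a family [F] that stands for the hyperplanes through the origin *)

Section Sections.
Variables (K1 : set V) (F : set (set V)).
Hypotheses (kK1 : compact K1) (sK1 : segment_interior K1) (K10 : K1 0).
Hypothesis coverF : forall x y, exists H, [/\ F H, H x & H y].
Hypothesis scaleF : forall H, F H -> forall (t : R) x, H x -> H (t *: x).

Lemma homothetic_of_touching K2 y : K2 `<=` K1 -> K2 y ->
  (forall s : R, 1 < s -> ~ K1 (s *: y)) ->
  (forall H, F H -> exists (l : R) v, 0 < l /\
     H `&` K2 = [set l *: x + v | x in H `&` K1]) ->
  exists l : R, 0 < l /\ K2 = [set l *: x + (1 - l) *: y | x in K1].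
Proof.
move=> K21 K2y touch hom.
have {}hom H : F H -> H y -> exists l : R, 0 < l /\
    H `&` K2 = [set l *: x + (1 - l) *: y | x in H `&` K1].
  move=> FH Hy; have [l [v [l0 E]]] := hom H FH.
  exists l; split => //; rewrite E.
  suff -> : v = (1 - l) *: y by [].
  apply: (@homothety_fixes_touching_point K1 (H `&` K1) l v y) => //.
  - split => //; rewrite -(scale0r y); exact: scaleF.
  - by rewrite -E => x [Hx K2x]; split => //; exact: K21.
  - by rewrite -E.
have [M _ hM] := compact_norm_le kK1.
have yn0 : 0 < `|y|.
  rewrite normr_gt0; apply/eqP => y0; apply: (touch 2); first by lra.
  by rewrite y0 scaler0.
(* One inequality suffices: exchanging [H] and [G] gives equality of the ratios. *)
have ratio_le H G (l m : R) : H y -> G y -> F H -> F G -> 0 < l -> 0 < m ->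
    H `&` K2 = [set l *: x + (1 - l) *: y | x in H `&` K1] ->
    G `&` K2 = [set m *: x + (1 - m) *: y | x in G `&` K1] -> l <= m.
  move=> Hy Gy FH FG l0 m0 EH EG.
  suff : l / m <= 1 by rewrite ler_pdivrMr// mul1r.
  apply: (@powers_bounded_le1 _ _ `|y| (M + `|y|)) => // k.
  (* On the line through 0 and y, which lies in H and G, the first homothety
     followed by the inverse of the second preserves K1; iterate it from 0. *)
  have K1k : K1 ((1 - (l / m) ^+ k) *: y).
    elim: k => [|k IH]; first by rewrite expr0 subrr scale0r.
    have : (H `&` K2) ((1 - l * (l / m) ^+ k) *: y).
      rewrite EH; exists ((1 - (l / m) ^+ k) *: y).
        by split => //; exact: scaleF.
      by rewrite scalerA -scalerDl; congr (_ *: _); ring.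
    move=> [_ K2k].
    have : (G `&` K2) ((1 - l * (l / m) ^+ k) *: y).
      by split => //; exact: scaleF.
    rewrite EG => -[x [_ K1x]] /(canRL (addrK _)) xE.
    suff -> : (1 - (l / m) ^+ k.+1) *: y = x by [].
    apply: (scalerI (lt0r_neq0 m0)); rewrite xE scalerA -scalerBl.
    by congr (_ *: _); rewrite exprS; field; exact: lt0r_neq0.
  (* As [y - (l / m) ^+ k *: y] has norm at most [M], the subtracted term has norm at most
     [M + |y|]. *)
  have := hM _ K1k; rewrite scalerBl scale1r => yk.
  have <- : `|(l / m) ^+ k *: y| = (l / m) ^+ k * `|y|.
    by rewrite normrZ ger0_norm// exprn_ge0// divr_ge0// ltW.
  rewrite -[X in `|X|](subKr y) (le_trans (ler_normB _ _))// addrC.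
  by rewrite lerD2r.
have [H0 [FH0 H0y _]] := coverF y y.
have [l [l0 EH0]] := hom _ FH0 H0y.
have homl H : F H -> H y ->
    H `&` K2 = [set l *: x + (1 - l) *: y | x in H `&` K1].
  move=> FH Hy; have [m [m0 EH]] := hom _ FH Hy.
  suff -> : l = m by [].
  by apply/eqP; rewrite eq_le (ratio_le H0 H)//= (ratio_le H H0).
exists l; split => //; apply/seteqP; split => [z K2z|_ [x K1x <-]].
  have [H [FH Hy Hz]] := coverF y z.
  have : (H `&` K2) z by [].
  by rewrite homl// => -[x [_ K1x] <-]; exists x.
have [H [FH Hy Hx]] := coverF y x.
suff [] : (H `&` K2) (l *: x + (1 - l) *: y) by [].
by rewrite homl//; exists x.
Qed.

Lemma homothetic_of_sections K2 : segment_closed K1 -> K1° 0 -> compact K2 ->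
  (exists2 w, K2 w & w != 0) ->
  (forall H, F H -> exists (l : R) v, 0 < l /\
     H `&` K2 = [set l *: x + v | x in H `&` K1]) ->
  exists (l : R) v, 0 < l /\ K2 = [set l *: x + v | x in K1].
Proof.
move=> cK1 iK10 kK2 K2w hom.
have [s s0 [sK [y K2y touch]]] := exists_touching_dilation kK1 cK1 iK10 kK2 K2w.
have sn : s != 0 by rewrite gt_eqF.
have scalesK K : [set s^-1 *: x | x in [set s *: x | x in K]] = K.
  rewrite image_comp -[RHS]image_id; apply: eq_imagel => x _ /=.
  by rewrite scalerA mulVf// scale1r.
have [||||l [l0 E]] := @homothetic_of_touching [set s *: x | x in K2] (s *: y).
- by move=> _ [x K2x <-]; exact: sK.
- by exists y.
- exact: touch.
- move=> H FH; have [l [v [l0 E]]] := hom H FH.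
  exists (s * l), (s *: v); split; first by rewrite mulr_gt0.
  (* Members of [F] are stable under real scaling, so dilating [K2] dilates its sections. *)
  have -> : H `&` [set s *: x | x in K2] = [set s *: x | x in H `&` K2].
    apply/seteqP; split => [z [Hz [x K2x xE]]|_ [x [Hx K2x] <-]].
      exists x => //; split => //.
      by rewrite -(scale1r x) -(mulVf sn) -scalerA xE; exact: scaleF.
    by split; [exact: scaleF | exists x].
  rewrite E image_comp; apply: eq_imagel => x _ /=.
  by rewrite scalerDr scalerA.
exists (s^-1 * l), (s^-1 *: ((1 - l) *: (s *: y))); split.
  by rewrite mulr_gt0// invr_gt0.
rewrite -[LHS]scalesK E image_comp; apply: eq_imagel => x _ /=.
by rewrite scalerDr scalerA.
Qed.
End Sections.
End Convex.

(** * Subspaces of prescribed dimension *)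

(** A basis of [U] followed by one of a complement is a basis of the space; its first [k] vectors
    include the basis of [U]. *)
Lemma subspace_extension (K : fieldType) (vT : vectType K) (U : {vspace vT}) k :
  (\dim U <= k <= \dim {:vT})%N ->
  exists2 W : {vspace vT}, (U <= W)%VS & \dim W = k.
Proof.
move=> /andP[Uk kT].
pose X := vbasis U ++ vbasis U^C%VS.
have fX : free X.
  rewrite cat_free !(basis_free (vbasisP _))/= directv_addE /=.
  rewrite !(span_basis (vbasisP _)) !directv_trivial /=.
  by rewrite capv_compl.
have sX : size X = \dim {:vT}.
  by rewrite size_cat !size_tuple dimv_compl subnKC// dimvS// subvf.
exists <<take k X>>%VS.
  rewrite -(span_basis (vbasisP U)); apply: sub_span => v vU.
  by rewrite take_cat size_tuple ltnNge Uk /= mem_cat vU.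
have ft : free (take k X).
  by move: fX; rewrite -{1}(cat_take_drop k X) => /catl_free.
by move: ft; rewrite /free => /eqP->; rewrite size_take_min sX; exact/minn_idPl.
Qed.

(** * Invariance under translation *)

Section Translation.
Variables (R : realType) (V : normedModType R).
Implicit Types (K : set V) (p : V).

Lemma interior_translate K p x : K° (x + p) -> [set u - p | u in K]° x.
Proof.
rewrite /interior /= => Kxp.
have cp : y + p @[y --> x] --> x + p.
  by apply: cvgD; [exact: cvg_id | exact: cvg_cst].
have : \forall y \near x, K (y + p) by apply: cp.
apply: filterS => y Ky.
by exists (y + p) => //; rewrite addrK.
Qed.

Lemma nbhs0_exists_neq0 K p : p != 0 -> K° 0 -> exists2 w, K w & w != 0.
Proof.
move=> p0 K0.
have c0 : t *: p @[t --> (0 : R)^'+] --> 0.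
  apply: cvg_at_right_filter; rewrite -[X in _ --> X](scale0r p).
  by apply: cvgZl; exact: cvg_id.
have nearK : \forall t \near (0 : R)^'+, K (t *: p) by apply: c0.
have [t [t0 Kt]] := filter_ex (filterI (nbhs_right_gt (0 : R)) nearK).
by exists (t *: p) => //; rewrite scaler_eq0 negb_or p0 gt_eqF.
Qed.

Lemma compact_translate K p : compact K -> compact [set u - p | u in K].
Proof.
move=> kK; apply: continuous_compact => //.
apply: continuous_subspaceT => x.
by apply: cvgB; [exact: cvg_id | exact: cvg_cst].
Qed.

Lemma segment_closed_translate K p :
  segment_closed K -> segment_closed [set u - p | u in K].
Proof.
move=> cK _ _ [a Ka <-] [b Kb <-] t t01.
exists ((1 - t) *: a + t *: b); first exact: cK.
by rewrite !scalerBr addrACA -opprD -scalerDl subrK scale1r.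
Qed.

Lemma segment_interior_translate K p :
  segment_interior K -> segment_interior [set u - p | u in K].
Proof.
move=> sK _ _ [a Ka <-] [b Kb <-] ab t t01; apply: interior_translate.
rewrite !scalerBr addrACA -opprD -scalerDl subrK scale1r subrK.
by apply: sK => //; apply: contraNneq ab => ->.
Qed.
End Translation.

(** * From complex row vectors to the real normed space of pairs of real rows *)

Section Realify.
Variables (R : realType) (n : nat).
Local Open Scope complex_scope.
Implicit Types (a b p z : 'rV[R[i]]_n) (K : set 'rV[R[i]]_n).

Definition complexify (u : 'rV[R]_n * 'rV[R]_n) : 'rV[R[i]]_n :=
  \row_j (u.1 0 j +i* u.2 0 j).

Lemma realifyK : cancel (@realify R n) complexify.
Proof. by move=> z; apply/rowP => j; rewrite !mxE; case: (z 0 j). Qed.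

Lemma complexifyK : cancel complexify (@realify R n).
Proof. by case=> u v; congr (_, _); apply/rowP => j; rewrite !mxE. Qed.

Lemma realifyD a b : realify (a + b) = realify a + realify b.
Proof.
by congr (_, _); apply/rowP => j; rewrite !mxE; case: (a 0 j) (b 0 j) => ? ? [].
Qed.

Lemma realifyN a : realify (- a) = - realify a.
Proof. by congr (_, _); apply/rowP => j; rewrite !mxE; case: (a 0 j). Qed.

Lemma realifyZ (t : R) a : realify (t%:C *: a) = t *: realify a.
Proof.
by congr (_, _); apply/rowP => j; rewrite !mxE; case: (a 0 j) => x y;
  rewrite /= mul0r ?subr0 ?addr0.
Qed.

Lemma realifyB a b : realify (a - b) = realify a - realify b.
Proof. by rewrite realifyD realifyN. Qed.

Lemma realify_inj : injective (@realify R n).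
Proof. exact: can_inj realifyK. Qed.

Lemma segment_closed_realify K :
  cconvex K -> segment_closed (@realify R n @` K).
Proof.
move=> cK _ _ [a Ka <-] [b Kb <-] t t01.
exists ((1 - t)%:C *: a + t%:C *: b); first exact: cK.
by rewrite realifyD !realifyZ.
Qed.

Lemma segment_interior_realify K : strictly_convex_body K ->
  segment_interior (@realify R n @` K).
Proof.
move=> [[cK _ _] sK]; apply: segment_interior_of_boundary.
  exact: segment_closed_realify.
move=> u v uv bd; apply: (sK (complexify u) (complexify v)).
  by apply: contraNneq uv => /(can_inj complexifyK) ->.
by move=> t /bd; rewrite /cboundary /cclosure /cinterior /=
  realifyD !realifyZ !complexifyK.
Qed.

(** Moving [p] to the origin turns affine sections through [p] into sections by linear hyperplanes,
    so that both bodies are cut by the same family. *)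
Definition centered p K := [set u - realify p | u in @realify R n @` K].

Lemma centered_realifyB p K z : centered p K (realify (z - p)) <-> K z.
Proof.
split=> [[_ [x Kx <-]]|Kz].
  by rewrite -realifyB => /realify_inj /addIr <-.
by exists (realify z); [exists z | rewrite realifyB].
Qed.

Lemma centered_csection (H : {vspace 'rV[R[i]]_n}) p K :
  @realify R n @` [set h | h \in H] `&` centered p K =
  [set realify (z - p) | z in csection H p K].
Proof.
apply/seteqP; split => [_ [[h Hh <-] Kh]|_ [z [[h Hh <-] Kz] <-]].
  exists (h + p); last by rewrite addrK.
  split; first by exists h.
  by apply/(centered_realifyB p); rewrite addrK.
by split; [exists h; rewrite ?addrK | exact/centered_realifyB].
Qed.
End Realify.

(** * Assembly: hyperplanes as the family [F], centered bodies as the sets *)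

Theorem theorem2p2 (R : realType) (n : nat) (hn : (3 <= n)%N)
    (K1 K2 : set 'rV[R[i]]_n) (p1 p2 : 'rV[R[i]]_n) :
  strictly_convex_body K1 -> strictly_convex_body K2 ->
  cinterior K1 p1 -> cinterior K2 p2 ->
  (forall H : {vspace 'rV[R[i]]_n}, \dim H = n.-1 ->
     pos_homothetic (csection H p1 K1) (csection H p2 K2)) ->
  pos_homothetic K1 K2.
Proof.
move=> sK1 sK2 K1p1 K2p2 hom.
have [[cK1 kK1 _] _] := sK1.
have [[_ kK2 _] _] := sK2.
pose F := [set @realify R n @` [set h | h \in H] |
  H in [set H : {vspace 'rV[R[i]]_n} | \dim H = n.-1]].
have coverF (u v : 'rV[R]_n * 'rV[R]_n) : exists H, [/\ F H, H u & H v].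
  pose U := (<[complexify u]> + <[complexify v]>)%VS.
  have [|H UH dH] := @subspace_extension _ _ U n.-1.
    (* Two vectors span dimension at most 2, which is at most [n.-1] because [3 <= n]. *)
    apply/andP; split; last by rewrite dimvf /dim /= mul1n leq_pred.
    have := (dimv_add_leqif <[complexify u]> <[complexify v]>).1.
    by rewrite !dim_vline => /leq_trans; apply; lia.
  exists (@realify R n @` [set h | h \in H]); split; first by exists H.
  - exists (complexify u); last exact: complexifyK.
    by apply: (subvP UH); apply: (subvP (addvSl _ _)); exact: memv_line.
  - exists (complexify v); last exact: complexifyK.
    by apply: (subvP UH); apply: (subvP (addvSr _ _)); exact: memv_line.
have scaleF H : F H -> forall (t : R) x, H x -> H (t *: x).
  move=> [H' _ <-] t _ [h Hh <-].
  by exists ((t%:C)%C *: h); [exact: memvZ | rewrite realifyZ].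
have zero_int p K : cinterior K p -> (centered p K)° 0.
  by move=> Kp; apply: interior_translate; rewrite add0r.
have e0 : (const_mx 1, 0) != 0 :> 'rV[R]_n * 'rV[R]_n.
  apply/eqP => -[/rowP/(_ (Ordinal (ltn_trans (ltn0Sn 1) hn)))] /eqP.
  by rewrite !mxE oner_eq0.
have [|||||||H [H' dH <-]|l [v [l0 E]]] := @homothetic_of_sections _ _
    (centered p1 K1) F _ _ _ coverF scaleF (centered p2 K2).
- exact: compact_translate.
- by apply: segment_interior_translate; exact: segment_interior_realify.
- by apply: interior_subset; exact: zero_int.
- by apply: segment_closed_translate; exact: segment_closed_realify.
- exact: zero_int.
- exact: compact_translate.
- apply: (@nbhs0_exists_neq0 _ _ _ (const_mx 1, 0)); first exact: e0.
  exact: zero_int.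
- have [l [v [l0 E]]] := hom H' dH.
  (* The section homothety conjugated by the two translations: [l (z - p1) + (l p1 + v - p2) = (l z
     + v) - p2]. *)
  exists l, (realify ((l%:C)%C *: p1 + v - p2)); split => //.
  rewrite !centered_csection E !image_comp; apply: eq_imagel => z _ /=.
  rewrite -realifyZ -realifyD; congr realify.
  by rewrite scalerBr !addrA subrK.
(* The reverse conjugation, from the centered bodies back to [K1] and [K2]. *)
exists l, (complexify v + p2 - (l%:C)%C *: p1); split => //.
have key z : l *: realify (z - p1) + v =
    realify ((l%:C)%C *: z + (complexify v + p2 - (l%:C)%C *: p1) - p2).
  rewrite -realifyZ -{1}(complexifyK v) -realifyD; congr realify.
  rewrite scalerBr -!addrA; congr (_ + _).
  by rewrite addrC; congr (_ + _); rewrite addrCA subrr addr0.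
apply/seteqP; split => [z /(centered_realifyB p2)|_ [z K1z <-]].
  rewrite E => -[_ [_ [w K1w <-] <-]].
  by rewrite -realifyB key => /realify_inj/addIr <-; exists w.
apply/(centered_realifyB p2); rewrite E -key; exists (realify (z - p1)) => //.
exact/centered_realifyB.
Qed.
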